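(* Let $m$ be an odd positive integer, and consider integer representations by the quadratic form $x^2+y^2+2z^2+2w^2$. (i) The number of $(x,y,z,w)\in\mathbb{Z}^4$ with $x^2+y^2+2z^2+2w^2=4m$, $x,y$ even and $z,w$ odd, is $4\sigma(m)$. (ii) The number of $(x,y,z,w)\in\mathbb{Z}^4$ with $x^2+y^2+2z^2+2w^2=8m$, $x,y$ even and $z,w$ odd, is $16\sigma(m)$. (iii) The number of $(x,y,z,w)\in\mathbb{Z}^4$ with $x^2+y^2+2z^2+2w^2=4m$, $x,y$ odd and $z,w$ of different parity, is $16\sigma(m)$.
   Context: $\sigma(m)$ denotes the sum of the positive divisors of $m$. *)

(* Defs.v *)
From mathcomp Require Import all_boot all_order all_algebra.
Set Implicit Arguments. Unset Strict Implicit. Unset Printing Implicit Defensive.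
Import Order.TTheory GRing.Theory Num.Theory.

Definition sigma (m : nat) : nat := \sum_(d <- divisors m) d.

Definition quad := (int * int * int * int)%type.

Definition Qf (v : quad) : int :=
  let: (x, y, z, w) := v in
  (x ^+ 2 + y ^+ 2 + 2 * z ^+ 2 + 2 * w ^+ 2)%R.

Definition zodd (x : int) : bool := odd `|x|%N.

Definition num_sols (P : quad -> bool) (n : nat) : Prop :=
  exists s : seq quad, [/\ uniq s, (forall v, (v \in s) = P v) & size s = n].

(* Main.v *)
(* Let a(n) be the number of representations of n as an ordered sum of four odd
   squares. Everything rests on a(4m) = 16 sigma(m) for odd m; the three counts
   then follow from substitutions such as (z, w) |-> (z + w, z - w).

   For N = 5 mod 8, both h = a and h(4m) = sigma(m) satisfy
     sum over odd j of (N - 5 j^2) h(N - j^2) = 0.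
   For a this is the symmetry of N = j^2 + x^2 + y^2 + z^2 + w^2 in its five
   variables. For sigma it is a statement about the triples (j, d, e) with
   j^2 + 4de = N and d, e > 0, that is, about the indefinite forms (d, j, -e) of
   discriminant N: the polynomial (d + e)(d + j)(e - j) changes sign under
   (j, d, e) |-> (-j - 2d, d, e - j - d), an involution of the triples with
   e > d + j, while (j, d, e) |-> (-j, e, d) preserves it and maps the other
   triples onto these, so its sum over all triples vanishes. As N - 5 > 0 for
   N = 4m + 1 with m > 1, the recurrence determines h(4m). *)
Require Import Defs.
From mathcomp Require Import all_boot all_order all_algebra.
From mathcomp Require Import zify ring.
Set Implicit Arguments. Unset Strict Implicit. Unset Printing Implicit Defensive.
Import Order.TTheory GRing.Theory Num.Theory.
Local Open Scope ring_scope.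

(** * Squares modulo 8 and modulo 4 *)

Lemma zodd_sqr (x : int) : zodd x -> exists a, x ^+ 2 = 8 * a + 1.
Proof.
rewrite /zodd => x_odd; have [a [->|->]] : exists a, x = 4 * a + 1 \/ x = 4 * a + 3.
- by exists (x %/ 4)%Z; lia.
- by exists (2 * a ^+ 2 + a); ring.
- by exists (2 * a ^+ 2 + 3 * a + 1); ring.
Qed.

Lemma zeven_sqr (x : int) : ~~ zodd x -> exists a, x ^+ 2 = 4 * a.
Proof.
rewrite /zodd => x_even; have -> : x = 2 * (x %/ 2)%Z by lia.
by exists ((x %/ 2)%Z ^+ 2); ring.
Qed.

(** * Reindexing lists and sums along bijections and involutions *)

Section SequenceBijections.
Variables T U : eqType.

Lemma perm_map_can (s : seq T) (t : seq U) (f : T -> U) (g : U -> T) :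
    uniq s -> uniq t ->
    {in s, forall x, f x \in t /\ g (f x) = x} ->
    {in t, forall y, g y \in s /\ f (g y) = y} ->
  perm_eq (map f s) t.
Proof.
move=> s_uniq t_uniq fP gP; apply: uniq_perm => // [|y].
  rewrite map_inj_in_uniq // => x y /fP[_ xK] /fP[_ yK] eq_f.
  by rewrite -xK eq_f yK.
apply/mapP/idP => [[x /fP[fx _] ->] //|/gP[gy yK]].
by exists (g y).
Qed.

Lemma uniq_allpairs_pair (s : seq T) (t : seq U) :
  uniq s -> uniq t -> uniq (allpairs pair s t).
Proof. by move=> s_uniq t_uniq; apply: allpairs_uniq => // -[? ?] []. Qed.

Lemma mem_allpairs_pair (s : seq T) (t : seq U) x y :
  ((x, y) \in allpairs pair s t) = (x \in s) && (y \in t).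
Proof.
apply/allpairsP/andP => [[[a b] [/= a_s b_t [-> ->]]] //|[x_s y_t]].
by exists (x, y).
Qed.

End SequenceBijections.

(** Applied with [P = Q] for a symmetry of the index set, and with [Q] the complement of [P] to
    carry the sum over one piece to the other. *)
Lemma big_involution (T : eqType) (s : seq T) (P Q : pred T) (h : T -> T)
    (F : T -> int) :
    uniq s -> involutive h ->
    {in s, forall x, P x -> (h x \in s) && Q (h x)} ->
    {in s, forall x, Q x -> (h x \in s) && P (h x)} ->
  \sum_(x <- s | Q x) F x = \sum_(x <- s | P x) F (h x).
Proof.
move=> s_uniq hK hP hQ; rewrite -[LHS]big_filter -[RHS]big_filter.
rewrite -(big_map h xpredT F) /=; apply/esym/perm_big.
apply: (@perm_map_can _ _ _ _ h h); rewrite ?filter_uniq // => x.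
  by rewrite mem_filter => /andP[Px xs]; rewrite mem_filter andbC hP ?hK.
by rewrite mem_filter => /andP[Qx xs]; rewrite mem_filter andbC hQ ?hK.
Qed.

(** * Finite enumerations of odd quadruples and of factorizations *)

Definition odd_box (n : nat) : seq int :=
  [seq x <- [seq i%:Z - n%:Z | i <- iota 0 (2 * n).+1] | zodd x].

Lemma odd_box_uniq n : uniq (odd_box n).
Proof.
rewrite filter_uniq // map_inj_in_uniq ?iota_uniq // => i j _ _ /addIr.
by case.
Qed.

Lemma mem_odd_box n x : (x \in odd_box n) = zodd x && (`|x| <= n)%N.
Proof.
rewrite mem_filter; congr (_ && _).
apply/mapP/idP => [[i]|x_le]; first by rewrite mem_iota; lia.
by exists (absz (x + n%:Z)); rewrite ?mem_iota; lia.
Qed.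

(** An integer satisfies [|x| <= x ^ 2], so the crude radius [|k|] already catches every
    solution. *)
Lemma mem_odd_box_sqr (k x y : int) :
  zodd x -> 0 <= y -> x ^+ 2 + y = k -> x \in odd_box `|k|.
Proof. by rewrite mem_odd_box => -> /= y_ge0 <-; nia. Qed.

Definition odd_quad (k : int) : pred quad := fun v =>
  let: (x, y, z, w) := v in
  [&& zodd x, zodd y, zodd z, zodd w & x ^+ 2 + y ^+ 2 + z ^+ 2 + w ^+ 2 == k].

(** The target is an integer because [N - j ^ 2] may be negative for [j] in the box; such terms then
    count nothing. *)
Definition odd_quads (k : int) : seq quad :=
  let B := odd_box `|k| in
  [seq v <- allpairs pair (allpairs pair (allpairs pair B B) B) B | odd_quad k v].

Lemma odd_quads_uniq k : uniq (odd_quads k).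
Proof. by rewrite filter_uniq // !uniq_allpairs_pair ?odd_box_uniq. Qed.

Lemma mem_odd_quads k v : (v \in odd_quads k) = odd_quad k v.
Proof.
rewrite mem_filter andb_idr //; case: v => [[[x y] z] w].
case/and5P=> x_odd y_odd z_odd w_odd /eqP sum_k.
rewrite !mem_allpairs_pair -!andbA; apply/and4P; split.
- apply: (@mem_odd_box_sqr k x (y ^+ 2 + z ^+ 2 + w ^+ 2)); nia.
- apply: (@mem_odd_box_sqr k y (x ^+ 2 + z ^+ 2 + w ^+ 2)); nia.
- apply: (@mem_odd_box_sqr k z (x ^+ 2 + y ^+ 2 + w ^+ 2)); nia.
- apply: (@mem_odd_box_sqr k w (x ^+ 2 + y ^+ 2 + z ^+ 2)); nia.
Qed.

Definition factor_pairs (k : int) : seq (int * int) :=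
  let R := [seq i%:Z | i <- iota 1 `|k|] in
  [seq p <- allpairs pair R R | 4 * p.1 * p.2 == k].

Lemma factor_pairs_uniq k : uniq (factor_pairs k).
Proof.
by rewrite filter_uniq // uniq_allpairs_pair // map_inj_uniq ?iota_uniq // => ? ? [].
Qed.

Lemma mem_factor_pairs k d e :
  ((d, e) \in factor_pairs k) = [&& 0 < d, 0 < e & 4 * d * e == k].
Proof.
rewrite mem_filter /= mem_allpairs_pair.
apply/andP/and3P => [[de_k /andP[/mapP[i] + d_i /mapP[j] + e_j]]|[d_gt0 e_gt0 /eqP de_k]].
  by rewrite !mem_iota; split=> //; lia.
rewrite de_k eqxx; split=> //; apply/andP; split; apply/mapP.
  by exists `|d|%N; rewrite ?mem_iota; nia.
by exists `|e|%N; rewrite ?mem_iota; nia.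
Qed.

(** The pairs are [(d, m / d)] for the divisors [d] of [m]. *)
Lemma sum_factor_pairs (m : nat) : (0 < m)%N ->
  \sum_(p <- factor_pairs (4 * m)%:Z) p.1 = (sigma m)%:Z.
Proof.
move=> m_gt0; rewrite /sigma (big_morph Posz PoszD (erefl _)).
pose f d := (d%:Z, (m %/ d)%N%:Z).
rewrite (perm_big (map f (divisors m))) /=; last first.
  rewrite perm_sym; apply: (@perm_map_can _ _ _ _ f (fun p => `|p.1|%N)) => [||d|[d e]].
  - exact: divisors_uniq.
  - exact: factor_pairs_uniq.
  - rewrite -dvdn_divisors // => /dvdnP[q m_eq].
    have d_gt0 : (0 < d)%N by case: d m_eq => //; lia.
    by rewrite /f m_eq mulnK // mem_factor_pairs; split=> //; nia.
  - rewrite mem_factor_pairs => /and3P[d_gt0 e_gt0 /eqP de_m].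
    have m_eq : m = (`|e| * `|d|)%N by nia.
    rewrite /f -dvdn_divisors // m_eq dvdn_mull // mulnK /=; last by lia.
    by split=> //; congr pair; lia.
by rewrite big_map.
Qed.

(** Grouping the five-square solutions by [j] turns a sum over them into the iterated sum of the
    recurrence. *)
Definition quints (N : int) : seq (int * quad) :=
  [seq (j, v) | j <- odd_box `|N|, v <- odd_quads (N - j ^+ 2)].

Definition triples (N : int) : seq (int * (int * int)) :=
  [seq (j, p) | j <- odd_box `|N|, p <- factor_pairs (N - j ^+ 2)].

Section DependentPairs.
Variables (T : eqType) (s : seq int) (t : int -> seq T).

Lemma uniq_dpairs :
  uniq s -> (forall j, uniq (t j)) -> uniq [seq (j, v) | j <- s, v <- t j].
Proof.
move=> s_uniq t_uniq; apply: allpairs_uniq_dep => // -[a b] [c d] _ _ /= [-> ->] //.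
Qed.

Lemma mem_dpairs j v :
  ((j, v) \in [seq (j, v) | j <- s, v <- t j]) = (j \in s) && (v \in t j).
Proof.
apply/allpairsPdep/andP => [[a [b [a_s b_t [-> ->]]]] //|[j_s v_t]].
by exists j, v.
Qed.

End DependentPairs.

Lemma mem_quints N j x y z w :
  ((j, (x, y, z, w)) \in quints N) =
  [&& zodd j, zodd x, zodd y, zodd z, zodd w &
      j ^+ 2 + x ^+ 2 + y ^+ 2 + z ^+ 2 + w ^+ 2 == N].
Proof.
rewrite mem_dpairs mem_odd_quads.
apply/andP/idP => [[]|].
  rewrite mem_odd_box => /andP[-> _] /and5P[-> -> -> -> /eqP e] /=.
  by apply/eqP; lia.
case/and5P=> j_odd x_odd y_odd z_odd /andP[w_odd /eqP sum_N]; split; last first.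
  by apply/and5P; split=> //; apply/eqP; lia.
by apply: (@mem_odd_box_sqr N j (x ^+ 2 + y ^+ 2 + z ^+ 2 + w ^+ 2)); nia.
Qed.

Lemma mem_triples N j d e :
  ((j, (d, e)) \in triples N) =
  [&& zodd j, 0 < d, 0 < e & j ^+ 2 + 4 * d * e == N].
Proof.
rewrite mem_dpairs mem_factor_pairs.
apply/andP/idP => [[]|].
  rewrite mem_odd_box => /andP[-> _] /and3P[-> -> /eqP de] /=.
  by apply/eqP; lia.
case/and4P=> j_odd d_gt0 e_gt0 /eqP sum_N; split.
  by apply: (@mem_odd_box_sqr N j (4 * d * e)) => //; nia.
by rewrite d_gt0 e_gt0; apply/eqP; lia.
Qed.

(** * The common recurrence, for four odd squares and for divisor sums *)

Lemma odd_quads_recurrence (N : int) :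
  \sum_(j <- odd_box `|N|) (N - 5 * j ^+ 2) * (size (odd_quads (N - j ^+ 2)))%:Z = 0.
Proof.
transitivity (\sum_(v <- quints N) (N - 5 * v.1 ^+ 2)).
  rewrite big_allpairs_dep; apply: eq_bigr => j _ /=.
  by rewrite big_const_seq count_predT iter_addr addr0 -[_ *+ size _]mulr_natr (natz (size _)).
have swap (h : int * quad -> int * quad) : involutive h ->
    {in quints N, forall v, h v \in quints N} ->
  \sum_(v <- quints N) v.1 ^+ 2 = \sum_(v <- quints N) (h v).1 ^+ 2.
  move=> hK hP; apply: (@big_involution _ _ xpredT xpredT h (fun v => v.1 ^+ 2)) => //.
  - by apply: uniq_dpairs => [|j]; rewrite ?odd_box_uniq ?odd_quads_uniq.
  - by move=> v /hP ->.
  - by move=> v /hP ->.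
pose h1 (v : int * quad) := let: (j, (x, y, z, w)) := v in (x, (j, y, z, w)).
pose h2 (v : int * quad) := let: (j, (x, y, z, w)) := v in (y, (x, j, z, w)).
pose h3 (v : int * quad) := let: (j, (x, y, z, w)) := v in (z, (x, y, j, w)).
pose h4 (v : int * quad) := let: (j, (x, y, z, w)) := v in (w, (x, y, z, j)).
have swap1 := swap h1; have swap2 := swap h2.
have swap3 := swap h3; have swap4 := swap h4.
(* Each term is zero, [N] being the sum of the five squares. By symmetry the five sums of squares
   agree, whence the weight [N - 5 * j ^ 2]. *)
have total : \sum_(v <- quints N) (N - v.1 ^+ 2 - (h1 v).1 ^+ 2 - (h2 v).1 ^+ 2
    - (h3 v).1 ^+ 2 - (h4 v).1 ^+ 2) = 0.
  rewrite big1_seq // => -[j [[[x y] z] w]] /=.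
  by rewrite mem_quints => /and5P[_ _ _ _ /andP[_ /eqP <-]]; ring.
rewrite -[RHS]total !big_split /= !sumrN -swap1 -?swap2 -?swap3 -?swap4 -?mulr_sumr;
  first ring.
all: move=> [j [[[x y] z] w]] //; rewrite !mem_quints.
all: by case/and5P=> -> -> -> -> /andP[-> /eqP <-] /=; apply/eqP; ring.
Qed.

Lemma factor_pairs_recurrence (N k : int) : N = 8 * k + 5 ->
  \sum_(j <- odd_box `|N|)
    (N - 5 * j ^+ 2) * \sum_(p <- factor_pairs (N - j ^+ 2)) p.1 = 0.
Proof.
move=> N_mod8; pose T := triples N.
pose d (v : int * (int * int)) := v.2.1; pose e (v : int * (int * int)) := v.2.2.
have T_uniq : uniq T.
  by apply: uniq_dpairs => [|j]; rewrite ?odd_box_uniq ?factor_pairs_uniq.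
pose neg (v : int * (int * int)) := (- v.1, v.2).
pose exch (v : int * (int * int)) := (- v.1, (e v, d v)).
(* This is the form [d X^2 + j X Y - e Y^2] under [X -> X + Y], followed by a change of sign of the
   middle coefficient. *)
pose shift (v : int * (int * int)) := (- v.1 - 2 * d v, (d v, e v - v.1 - d v)).
pose A (v : int * (int * int)) := d v + v.1 < e v.
pose F v := (d v + e v) * (d v + v.1) * (e v - v.1).
pose G v := d v * (d v * e v - v.1 ^+ 2).
have negK : involutive neg by case=> j p; rewrite /neg /= opprK.
have exchK : involutive exch by case=> j [x y]; rewrite /exch /= opprK.
have shiftK : involutive shift.
  by case=> j [x y]; rewrite /shift /d /e /=; congr (_, (_, _)); ring.
have sumA0 : \sum_(v <- T | A v) F v = 0.
  (* [shift] exchanges the factors [d + e] and [e - j] and negates [d + j], so [F] changes sign. The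
     condition [A] says that the new [e] is positive. *)
  suff : \sum_(v <- T | A v) F v = - \sum_(v <- T | A v) F v by lia.
  rewrite [LHS](@big_involution _ _ A A shift) // => [|[j [x y]]|[j [x y]]].
  - by rewrite -sumrN; apply: eq_bigr => -[j [x y]] _; rewrite /F /shift /exch /d /e /=; ring.
  - rewrite /A /shift /exch /d /e /= !mem_triples => /and4P[j_odd x_gt0 y_gt0 /eqP <-] lt_y.
    rewrite -!andbA; apply/and5P; split; [|lia|lia|apply/eqP; ring|lia].
    by move: j_odd; rewrite /zodd; lia.
  - rewrite /A /shift /exch /d /e /= !mem_triples => /and4P[j_odd x_gt0 y_gt0 /eqP <-] lt_y.
    rewrite -!andbA; apply/and5P; split; [|lia|lia|apply/eqP; ring|lia].
    by move: j_odd; rewrite /zodd; lia.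
(* [exch] swaps the factors [d + j] and [e - j], so it fixes [F], and it reverses the strict
   inequality in [A]. *)
have sumAC0 : \sum_(v <- T | ~~ A v) F v = 0.
  rewrite [LHS](@big_involution _ _ A (predC A) exch) // => [|[j [x y]]|[j [x y]]].
  - by rewrite -[RHS]sumA0; apply: eq_bigr => -[j [x y]] _; rewrite /F /shift /exch /d /e /=; ring.
  - rewrite /A /shift /exch /d /e /= !mem_triples => /and4P[j_odd x_gt0 y_gt0 /eqP <-] lt_y.
    rewrite -!andbA; apply/and5P; split; [|lia|lia|apply/eqP; ring|lia].
    by move: j_odd; rewrite /zodd; lia.
  - rewrite /A /shift /exch /d /e /= !mem_triples -leNgt => /and4P[j_odd x_gt0 y_gt0 /eqP eN] le_y.
    (* [y = x + j] would make [N] the square of the odd number [j + 2 * x]. *)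
    have neq_y : y != x + j.
      apply/eqP => y_eq; have /zodd_sqr[a sq] : zodd (j + 2 * x).
        by move: j_odd; rewrite /zodd; lia.
      suff : (j + 2 * x) ^+ 2 = N by lia.
      by rewrite -eN y_eq; ring.
    rewrite -!andbA; apply/and5P; split; [|lia|lia|rewrite -eN; apply/eqP; ring|lia].
    by move: j_odd; rewrite /zodd; lia.
have sumF0 : \sum_(v <- T) F v = 0 by rewrite (bigID A) /= sumA0 sumAC0.
have sum_inv h : involutive h -> {in T, forall v, h v \in T} ->
    forall H, \sum_(v <- T) H v = \sum_(v <- T) H (h v) :> int.
  move=> hK hT H; apply: (@big_involution _ _ xpredT xpredT) => // v /hT -> //.
have negT : {in T, forall v, neg v \in T}.
  move=> [j [x y]]; rewrite /neg /= !mem_triples sqrrN => /and4P[j_odd -> -> ->].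
  by rewrite !andbT; move: j_odd; rewrite /zodd; lia.
have exchT : {in T, forall v, exch v \in T}.
  move=> [j [x y]]; rewrite /exch /d /e /= !mem_triples.
  case/and4P=> j_odd -> -> /eqP <-; apply/andP; split; last by apply/eqP; ring.
  by move: j_odd; rewrite /zodd; lia.
have sumG0 : \sum_(v <- T) G v = 0.
  (* Adding the value at [-j] cancels the terms of [F] odd in [j] and leaves
     [2 (d + e) (d e - j ^ 2)], which is twice [G] symmetrized in [d] and [e]. *)
  have : \sum_(v <- T) (F v + F (neg v)) = \sum_(v <- T) 2 * (G v + G (exch v)).
    by apply: eq_bigr => -[j [x y]] _; rewrite /F /G /neg /exch /d /e /=; ring.
  rewrite -mulr_sumr !big_split /= -(sum_inv _ negK negT F) -(sum_inv _ exchK exchT G).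
  by rewrite sumF0; move: (\sum_(v <- T) G v) => S; lia.
(* Since [4 d e = N - j ^ 2], [4 G] equals [(N - 5 j ^ 2) d]. *)
transitivity (\sum_(v <- T) 4 * G v); last by rewrite -mulr_sumr sumG0.
rewrite big_allpairs_dep; apply: eq_bigr => j _ /=.
rewrite mulr_sumr big_seq [RHS]big_seq; apply: eq_bigr => -[x y].
rewrite mem_factor_pairs /G /d /e /= => /and3P[_ _ /eqP xy].
have -> : N = 4 * x * y + j ^+ 2 by lia.
ring.
Qed.

(** * Solving the recurrence *)

Lemma odd_quads_le0 (k : int) : k <= 0 -> odd_quads k = [::].
Proof.
move=> k_le0; case E: (odd_quads k) => [//|[[[x y] z] w] s].
have: (x, y, z, w) \in odd_quads k by rewrite E mem_head.
by rewrite mem_odd_quads => /and5P[/zodd_sqr[a x_odd] _ _ _ /eqP]; nia.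
Qed.

Lemma factor_pairs_le0 (k : int) : k <= 0 -> factor_pairs k = [::].
Proof.
move=> k_le0; case E: (factor_pairs k) => [//|[d e] s].
have: (d, e) \in factor_pairs k by rewrite E mem_head.
by rewrite mem_factor_pairs => /and3P[? ? /eqP]; nia.
Qed.

(** These are the sign patterns of [(1, 1, 1, 1)]. The recurrence says nothing here, since its
    coefficient [N - 5] is zero for [N = 5]. *)
Lemma size_odd_quads4 : size (odd_quads 4) = 16%N.
Proof. by vm_compute. Qed.

Lemma size_odd_quads (m : nat) : odd m ->
  (size (odd_quads (4 * m)%N))%:Z =
  16 * \sum_(p <- factor_pairs (4 * m)%N) p.1.
Proof.
elim/ltn_ind: m => m IH m_odd; have [->|m_neq1] := eqVneq m 1%N.
  by rewrite sum_factor_pairs // /sigma (_ : divisors 1 = [:: 1%N]) // big_seq1 size_odd_quads4.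
pose h (k : int) : int :=
  (size (odd_quads k))%:Z - 16 * \sum_(p <- factor_pairs k) p.1.
pose N : int := (4 * m)%N%:Z + 1.
have sum_h0 : \sum_(j <- odd_box `|N|) (N - 5 * j ^+ 2) * h (N - j ^+ 2) = 0.
  under eq_bigr => j _ do rewrite /h [_ * _]mulrBr [(_ - _) * (16 * _)]mulrCA.
  rewrite big_split sumrN -mulr_sumr odd_quads_recurrence.
  by rewrite (@factor_pairs_recurrence _ (m %/ 2)%N%:Z) ?mulr0 // /N; lia.
suff h0 : h (4 * m)%N = 0 by move: h0; rewrite /h; lia.
(* For [j ^ 2 = 8 a + 1] the argument is [4 (m - 2 a)]. Unless [a = 0], either it is nonpositive and
   both parts of [h] vanish, or [m - 2 a] is a smaller odd number and induction applies. *)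
have terms j : j \in odd_box `|N| ->
    (N - 5 * j ^+ 2) * h (N - j ^+ 2) =
    if j ^+ 2 == 1 then (N - 5) * h (4 * m)%N else 0.
  rewrite mem_odd_box => /andP[/zodd_sqr[a sq_a] _].
  case: ifPn => [/eqP ->|sq_neq1]; first by congr (_ * h _); rewrite /N; lia.
  rewrite [h _](_ : _ = 0) ?mulr0 // /h.
  have [le0|gt0] := lerP (N - j ^+ 2) 0.
    by rewrite odd_quads_le0 // factor_pairs_le0 // big_nil.
  have a_gt0 : 0 < a by have := sqr_ge0 j; lia.
  have -> : N - j ^+ 2 = (4 * `|(m%:Z - 2 * a)%R|)%N by move: gt0; rewrite /N; lia.
  by rewrite IH ?subrr //; move: gt0; rewrite /N; lia.
move: sum_h0; rewrite (eq_big_seq _ terms) -big_mkcond big_const_seq iter_addr addr0.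
(* The sum is [(N - 5) h(4 m)] times the number of [j] in the box with [j ^ 2 = 1]. That number is
   positive because of [j = 1], and [N - 5 = 4 (m - 1)] is nonzero. *)
move/eqP; rewrite mulrn_eq0 mulf_eq0 => /or3P[|/eqP|/eqP //]; last by rewrite /N; lia.
rewrite eqn0Ngt -has_count => /negP[]; apply/hasP; exists 1 => //.
by rewrite mem_odd_box /zodd /N; lia.
Qed.

Lemma size_odd_quads_sigma (m : nat) : odd m ->
  size (odd_quads (4 * m)%N) = (16 * sigma m)%N.
Proof.
move=> m_odd; have := size_odd_quads m_odd.
by rewrite sum_factor_pairs ?odd_gt0 //; lia.
Qed.

(** * Transport and halving of solution counts *)

Lemma num_sols_bij (P Q : quad -> bool) (f g : quad -> quad) n :
    (forall v, P v -> Q (f v) /\ g (f v) = v) ->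
    (forall v, Q v -> P (g v) /\ f (g v) = v) ->
  num_sols P n -> num_sols Q n.
Proof.
move=> fP gQ [s [s_uniq mem_s <-]]; exists (map f s); split; last exact: size_map.
  rewrite map_inj_in_uniq // => u v; rewrite !mem_s => /fP[_ uK] /fP[_ vK] eq_f.
  by rewrite -uK eq_f vK.
move=> v; apply/mapP/idP => [[u]|/gQ[Pg vK]]; first by rewrite mem_s => /fP[Qf _] ->.
by exists (g v); rewrite ?mem_s.
Qed.

(** [h] pairs the solutions satisfying [R] with those violating it. *)
Lemma num_sols_halve (P R : quad -> bool) (h : quad -> quad) n :
    involutive h -> (forall v, P v -> P (h v) /\ R (h v) = ~~ R v) ->
  num_sols P (2 * n) -> num_sols (fun v => P v && R v) n.
Proof.
move=> hK hP [s [s_uniq mem_s size_s]]; exists (filter R s).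
split; first exact: filter_uniq.
  by move=> v; rewrite mem_filter mem_s andbC.
have: perm_eq (map h (filter R s)) (filter (predC R) s).
  apply: (@perm_map_can _ _ _ _ h h); rewrite ?filter_uniq // => v;
    rewrite !mem_filter !mem_s /= => /andP[Rv /hP[-> ->]];
    by rewrite ?Rv ?hK ?negbK.
move/perm_size; rewrite size_map !size_filter => eq_count.
by have := count_predC R s; rewrite size_s -eq_count; lia.
Qed.

Lemma num_sols_odd_quad (m : nat) : odd m ->
  num_sols (odd_quad (4 * m)%N) (16 * sigma m).
Proof.
move=> m_odd; exists (odd_quads (4 * m)%N).
by split; [exact: odd_quads_uniq | exact: mem_odd_quads | exact: size_odd_quads_sigma].
Qed.

(** * The rotation [(p, q) -> (p + q, p - q)] *)

Definition mixed_quad (n : nat) : pred quad := fun v =>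
  let: (p, q, r, s) := v in
  [&& zodd p != zodd q, zodd r != zodd s &
      p ^+ 2 + q ^+ 2 + r ^+ 2 + s ^+ 2 == n].

Definition half (x : int) : int := (x %/ 2)%Z.

Lemma halfD (p q : int) : half (p + q + (p - q)) = p.
Proof. by rewrite /half; lia. Qed.

Lemma halfB (p q : int) : half (p + q - (p - q)) = q.
Proof. by rewrite /half; lia. Qed.

Lemma zoddD (p q : int) : zodd (p + q) = (zodd p != zodd q).
Proof. by rewrite /zodd; lia. Qed.

Lemma zoddB (p q : int) : zodd (p - q) = (zodd p != zodd q).
Proof. by rewrite /zodd; lia. Qed.

Lemma same_parity_rotate (x y : int) :
  zodd x = zodd y -> exists p q, x = p + q /\ y = p - q.
Proof.
by move=> xy; exists (half (x + y)), (half (x - y)); move: xy; rewrite /zodd /half; lia.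
Qed.

Lemma sum_sqr_rotate (p q : int) :
  (p + q) ^+ 2 + (p - q) ^+ 2 = 2 * p ^+ 2 + 2 * q ^+ 2.
Proof. ring. Qed.

(** Rotating both pairs doubles the sum of squares, and [p + q], [p - q] are odd exactly when [p],
    [q] have opposite parity; so these solutions correspond to the odd quadruples for [4 m]. *)
Lemma num_sols_mixed_quad (m : nat) : odd m ->
  num_sols (mixed_quad (2 * m)) (16 * sigma m).
Proof.
move/num_sols_odd_quad; apply: (@num_sols_bij _ _
  (fun v => let: (x, y, z, w) := v in
     (half (x + y), half (x - y), half (z + w), half (z - w)))
  (fun v => let: (p, q, r, s) := v in (p + q, p - q, r + s, r - s))).
- move=> [[[x y] z] w] /and5P[x_odd y_odd z_odd w_odd /eqP].
  have [p [q [eq_x eq_y]]] := same_parity_rotate (etrans x_odd (esym y_odd)).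
  have [r [s [eq_z eq_w]]] := same_parity_rotate (etrans z_odd (esym w_odd)).
  move: x_odd z_odd; rewrite eq_x eq_y eq_z eq_w !halfD !halfB => pq_odd rs_odd.
  rewrite -addrA !sum_sqr_rotate => sum_m; split=> //.
  by rewrite /mixed_quad -!zoddD pq_odd rs_odd; clear -sum_m; lia.
- move=> [[[p q] r] s] /and3P[pq_odd rs_odd /eqP sum_m].
  rewrite !halfD !halfB; split=> //.
  rewrite /odd_quad !zoddB !zoddD pq_odd rs_odd -addrA !sum_sqr_rotate.
  by clear -sum_m; lia.
Qed.

(* The three counts for [x^2 + y^2 + 2 z^2 + 2 w^2] *)
Local Close Scope ring_scope.

Theorem theorem58 (m : nat) (hm : 0 < m) (hodd : odd m) :
  [/\ num_sols (fun v : quad => let: (x, y, z, w) := v in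
        [&& Qf v == Posz (4 * m), ~~ zodd x, ~~ zodd y, zodd z & zodd w])
        (4 * sigma m),
      num_sols (fun v : quad => let: (x, y, z, w) := v in
        [&& Qf v == Posz (8 * m), ~~ zodd x, ~~ zodd y, zodd z & zodd w])
        (16 * sigma m)
    & num_sols (fun v : quad => let: (x, y, z, w) := v in
        [&& Qf v == Posz (4 * m), zodd x, zodd y & zodd z != zodd w])
        (16 * sigma m)].
Proof.
split.
- pose h1 (v : quad) : quad := let: (p, q, r, s) := v in (q, p, r, s).
  pose h2 (v : quad) : quad := let: (p, q, r, s) := v in (p, q, s, r).
  pose even1 (v : quad) := let: (p, q, r, s) := v in ~~ zodd p.
  pose even3 (v : quad) := let: (p, q, r, s) := v in ~~ zodd r.
  (* The factor [16] is split as [2 * 2 * 4]: one halving makes [p] the even entry of its pair, the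
     other does so for [r]. *)
  have sols : num_sols (mixed_quad (2 * m)) (2 * (2 * (4 * sigma m))).
    by rewrite !mulnA; apply: num_sols_mixed_quad.
  have {}sols : num_sols (fun v => (mixed_quad (2 * m) v && even1 v) && even3 v)
                  (4 * sigma m).
    apply: (@num_sols_halve _ _ h2) => [[[[p q] r] s] //|[[[p q] r] s]|].
      case/andP=> /and3P[pq_odd rs_odd sum_m] p_even.
      rewrite [even1 _]p_even /mixed_quad /= pq_odd (eq_sym (zodd s)) rs_odd.
      rewrite addrAC sum_m; split=> //.
      by move: rs_odd; rewrite /even3; case: (zodd r); case: (zodd s).
    apply: (@num_sols_halve _ _ h1) => [[[[p q] r] s] //|[[[p q] r] s]|//].
    case/and3P=> pq_odd rs_odd sum_m.
    rewrite /mixed_quad /= (eq_sym (zodd q)) pq_odd rs_odd (addrC (q ^+ 2)%R) sum_m.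
    by split=> //; move: pq_odd; rewrite /even1; case: (zodd p); case: (zodd q).
  (* Rotating the even entries [p], [r] gives even [x], [y] and doubles their squares; the odd
     entries [q], [s] get coefficient 2 from the form, so [2 m] becomes [4 m]. *)
  move: sols; apply: (@num_sols_bij _ _
    (fun v => let: (p, q, r, s) := v in (p + r, p - r, q, s)%R)
    (fun v => let: (x, y, z, w) := v in (half (x + y)%R, z, half (x - y)%R, w))).
  + move=> [[[p q] r] s] /andP[/andP[/and3P[]]].
    rewrite /even1 /even3 halfD halfB zoddB zoddD /Qf sum_sqr_rotate.
    move=> pq_odd rs_odd /eqP sum_m p_even r_even; split=> //; apply/and5P; split.
    * by clear -sum_m; apply/eqP; lia.
    * by rewrite (negPf p_even) (negPf r_even).
    * by rewrite (negPf p_even) (negPf r_even).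
    * by move: pq_odd; rewrite (negPf p_even); case: (zodd q).
    * by move: rs_odd; rewrite (negPf r_even); case: (zodd s).
  + move=> [[[x y] z] w] /and5P[/eqP sum_m x_even y_even z_odd w_odd].
    have xy_parity : zodd x = zodd y by rewrite (negPf x_even) (negPf y_even).
    have [p [r [eq_x eq_y]]] := same_parity_rotate xy_parity.
    move: x_even sum_m; rewrite eq_x eq_y halfD halfB zoddD /Qf sum_sqr_rotate.
    move=> /negbNE/eqP pr_parity sum_m.
    (* Otherwise [p ^ 2 + r ^ 2 + z ^ 2 + w ^ 2 = 2 * m] would be divisible by [4]. *)
    have p_even : ~~ zodd p.
      apply/negP=> p_odd; have r_odd : zodd r by rewrite -pr_parity.
      have [[a sq_p] [b sq_r]] := (zodd_sqr p_odd, zodd_sqr r_odd).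
      have [[c sq_z] [d sq_w]] := (zodd_sqr z_odd, zodd_sqr w_odd).
      by clear -sum_m sq_p sq_r sq_z sq_w hodd; lia.
    rewrite /mixed_quad /even1 /even3 -pr_parity p_even (negPf p_even) z_odd w_odd.
    by split=> //; clear -sum_m; lia.
(* Rotating the first pair doubles its squares and the form doubles the others, so [4 m] becomes
   [8 m]. *)
- move: (num_sols_odd_quad hodd); apply: (@num_sols_bij _ _
    (fun v => let: (x, y, z, w) := v in (x + y, x - y, z, w)%R)
    (fun v => let: (x, y, z, w) := v in (half (x + y)%R, half (x - y)%R, z, w))).
  + move=> [[[x y] z] w] /and5P[x_odd y_odd z_odd w_odd /eqP sum_m].
    rewrite halfD halfB zoddB zoddD x_odd y_odd z_odd w_odd /Qf sum_sqr_rotate.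
    by split=> //; clear -sum_m; lia.
  + move=> [[[x y] z] w] /and5P[/eqP sum_m x_even y_even z_odd w_odd].
    have xy_parity : zodd x = zodd y by rewrite (negPf x_even) (negPf y_even).
    have [p [q [eq_x eq_y]]] := same_parity_rotate xy_parity.
    move: x_even sum_m; rewrite eq_x eq_y halfD halfB zoddD /Qf sum_sqr_rotate.
    move=> /negbNE/eqP pq_parity sum_m.
    (* Otherwise [p ^ 2 + q ^ 2 + z ^ 2 + w ^ 2 = 4 * m] would be [2] mod [4]. *)
    have p_odd : zodd p.
      apply/negPn/negP=> p_even; have q_even : ~~ zodd q by rewrite -pq_parity.
      have [[a sq_p] [b sq_q]] := (zeven_sqr p_even, zeven_sqr q_even).
      have [[c sq_z] [d sq_w]] := (zodd_sqr z_odd, zodd_sqr w_odd).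
      by clear -sum_m sq_p sq_q sq_z sq_w; lia.
    rewrite /odd_quad -pq_parity p_odd z_odd w_odd.
    by split=> //; clear -sum_m; lia.
(* Only the last pair is rotated, backwards: this halves its squares, which the coefficients 2 of
   the form make up for, so the value stays [4 m]. *)
- move: (num_sols_odd_quad hodd); apply: (@num_sols_bij _ _
    (fun v => let: (x, y, z, w) := v in (x, y, half (z + w)%R, half (z - w)%R))
    (fun v => let: (x, y, z, w) := v in (x, y, z + w, z - w)%R)).
  + move=> [[[x y] z] w] /and5P[x_odd y_odd z_odd w_odd /eqP].
    have [r [s [eq_z eq_w]]] := same_parity_rotate (etrans z_odd (esym w_odd)).
    move: z_odd; rewrite eq_z eq_w halfD halfB zoddD -addrA sum_sqr_rotate.
    move=> rs_odd sum_m; rewrite x_odd y_odd rs_odd /Qf.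
    by split=> //; clear -sum_m; lia.
  + move=> [[[x y] z] w] /and4P[/eqP sum_m x_odd y_odd zw_odd].
    rewrite halfD halfB /odd_quad zoddB zoddD x_odd y_odd zw_odd -addrA sum_sqr_rotate.
    by split=> //; clear -sum_m; move: sum_m; rewrite /Qf; lia.
Qed.
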